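(* Let $r\leq s\leq n-1$ be positive integers. Then the panhandle matroid $\mathsf{Pan}_{r,s,n}$ is Ehrhart positive, i.e. the Ehrhart polynomial of its matroid base polytope has nonnegative coefficients.
   Context: For a matroid $M$ with ground set $[n]=\{1,\dots,n\}$, its matroid (base) polytope $\mathcal{P}_M\subset\mathbb{R}^n$ is the convex hull of the indicator vectors of the bases of $M$. For a lattice polytope $P\subset\mathbb{R}^d$, its Ehrhart polynomial is the polynomial in $t$ that agrees with $|tP\cap\mathbb{Z}^d|$ for all integers $t\ge 0$. The Ehrhart polynomial $\mathsf{ehr}_M(t)$ of a matroid $M$ is that of $\mathcal{P}_M$; $M$ is Ehrhart positive if all coefficients of $\mathsf{ehr}_M(t)$ are nonnegative. For $1\le r\le s<n$, the panhandle matroid $\mathsf{Pan}_{r,s,n}$ is the matroid of rank $r$ on $[n]$ whose set of bases is $$\mathcal{B}_{r,s,n}=\left\{B\in\binom{[n]}{r} : |B\cap[s]|\geq r-1\right\}.$$ *)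

(* Defs.v *)
From HB Require Import structures.
From mathcomp Require Import all_boot all_order all_algebra finmap.
From mathcomp Require Import boolp classical_sets functions cardinality.
From mathcomp Require Import reals convex.
Set Implicit Arguments.
Unset Strict Implicit.
Unset Printing Implicit Defensive.
Import Order.TTheory GRing.Theory Num.Theory.
Local Open Scope classical_set_scope.
Local Open Scope ring_scope.

Record matroid (E : finType) := Matroid {
  bases : {set {set E}};
  bases_neq0 : bases != finset.set0;
  bases_exchange : forall A B : {set E}, A \in bases -> B \in bases ->
    forall a, a \in A :\: B ->
      exists2 b, b \in B :\: A & b |: (A :\ a) \in bases
}.

Definition convex_hull (R : realType) (V : lmodType R) (A : set V) : set V :=
  smallest (@convex_set R V) A.

Definition indicator_vector (R : realType) (n : nat) (B : {set 'I_n}) :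
  'rV[R]_n := \row_i (i \in B)%:R.
Arguments indicator_vector R {n} B.

Definition base_polytope (R : realType) (n : nat) (M : matroid 'I_n) :
  set 'rV[R]_n :=
  convex_hull [set indicator_vector R B | B in [set` bases M]].
Arguments base_polytope R {n} M.

Definition integer_points (R : realType) (n : nat) : set 'rV[R]_n :=
  range (fun z : 'rV[int]_n => map_mx intr z).
Arguments integer_points R n : clear implicits.

Definition dilate (R : realType) (n : nat) (t : nat) (P : set 'rV[R]_n) :
  set 'rV[R]_n := [set t%:R *: x | x in P].

(* The finiteness clause matters: [fset_set] is empty on infinite sets. *)
Definition is_ehrhart_poly (R : realType) (n : nat) (P : set 'rV[R]_n)
    (p : {poly rat}) : Prop :=
  forall t : nat,
    finite_set (dilate t P `&` integer_points R n) /\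
    p.[t%:R] = #|` fset_set (dilate t P `&` integer_points R n)|%:R.

Lemma is_ehrhart_poly_unique (R : realType) (n : nat) (P : set 'rV[R]_n)
    (p q : {poly rat}) :
  is_ehrhart_poly P p -> is_ehrhart_poly P q -> p = q.
Proof.
move=> hp hq; apply/eqP; rewrite -subr_eq0; apply/negPn/negP => pq0.
pose s : seq rat := [seq t%:R | t <- iota 0 (size (p - q))].
have us : uniq s.
  by rewrite map_inj_uniq ?iota_uniq // => a b /eqP; rewrite eqr_nat => /eqP.
have rs : all (root (p - q)) s.
  apply/allP => _ /mapP[t _ ->].
  by rewrite /root !hornerE (hp t).2 (hq t).2 subrr.
by have := max_poly_roots pq0 rs us; rewrite size_map size_iota ltnn.
Qed.

(* Existence of the polynomial is part of the assertion; by the previous lemma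
   the witness can only be the Ehrhart polynomial. *)
Definition ehrhart_positive (R : realType) (n : nat) (M : matroid 'I_n) :
  Prop :=
  exists2 p : {poly rat}, is_ehrhart_poly (base_polytope R M) p &
    forall i : nat, 0 <= p`_i.
Arguments ehrhart_positive R {n} M.

(* The ground set [n] = {1, ..., n} is shifted to 'I_n = {0, ..., n - 1}. *)
Definition initial_segment (s n : nat) : {set 'I_n} :=
  [set i : 'I_n | (i < s)%N]%SET.

Definition panhandle_bases (r s n : nat) : {set {set 'I_n}} :=
  [set B : {set 'I_n} |
    (#|B| == r) && (r - 1 <= #|B :&: initial_segment s n|)%N]%SET.

Lemma panhandle_bases_neq0 (r s n : nat) (r_gt0 : (0 < r)%N)
    (le_rs : (r <= s)%N) (lt_sn : (s < n)%N) :
  panhandle_bases r s n != finset.set0.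
Proof.
have le_rn : (r <= n)%N := leq_trans le_rs (ltnW lt_sn).
apply/set0Pn; exists [set widen_ord le_rn i | i : 'I_r]%SET.
have cB : #|[set widen_ord le_rn i | i : 'I_r]%SET| = r.
  by rewrite card_imset ?card_ord // => i j [] /val_inj.
rewrite inE cB eqxx /= (_ : _ :&: _ = [set widen_ord le_rn i | i : 'I_r])%SET.
  by rewrite cB leq_subr.
apply/finset.setIidPl/fintype.subsetP => _ /imsetP[i _ ->].
by rewrite inE /= (leq_trans (ltn_ord i)).
Qed.

Lemma panhandle_bases_exchange (r s n : nat) (A B : {set 'I_n}) :
  A \in panhandle_bases r s n -> B \in panhandle_bases r s n ->
  forall a, a \in A :\: B ->
    exists2 b, b \in B :\: A & b |: (A :\ a) \in panhandle_bases r s n.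
Proof.
set S := initial_segment s n.
rewrite !finset.in_set => /andP[/eqP cA sA] /andP[/eqP cB sB] a.
rewrite finset.in_setD => /andP[aB aA].
have cAa b : b \notin A -> #|b |: (A :\ a)| = r.
  by move=> bA; rewrite cardsU1 !inE (negPf bA) andbF -cA (cardsD1 a A) aA.
have ex_new (C D : {set 'I_n}) :
    (#|C| <= #|D|)%N -> a \in C -> a \notin D -> exists2 b, b \in D & b \notin C.
  move=> leCD aC aD; apply/fintype.subsetPn/negP => sDC.
  have /eqP eDC : D == C by rewrite eqEcard sDC.
  by rewrite eDC aC in aD.
have [le_r|gt_r] := leqP (r - 1) #|(A :\ a) :&: S|.
  have [|b bB bA] := ex_new A B _ aA aB; first by rewrite cA cB.
  exists b; rewrite !finset.in_set ?bA // cAa // eqxx /=.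
  by rewrite (leq_trans le_r) // subset_leq_card // finset.setSI // finset.subsetUr.
have aS : a \in S.
  apply: contraTT gt_r => aS; rewrite -leqNgt (leq_trans sA) //.
  apply/subset_leq_card/fintype.subsetP => i; rewrite !finset.in_setI.
  move=> /andP[iA iS]; rewrite iS finset.in_setD1 iA !andbT.
  by apply: contraNneq aS => <-.
have cAS : #|A :&: S| = #|(A :\ a) :&: S|.+1.
  by rewrite (cardsD1 a) inE aA aS finset.setIDAC.
have [|||b] := ex_new (A :&: S) (B :&: S).
- by rewrite cAS (leq_trans gt_r).
- by rewrite inE aA.
- by rewrite inE (negPf aB).
rewrite !finset.in_setI => /andP[bB bS]; rewrite bS andbT => bA.
exists b; rewrite !finset.in_set ?bA // cAa // eqxx /=.
rewrite (leq_trans sA) // cAS (cardsD1 b ((b |: _) :&: S)) finset.in_setI finset.setU11 bS ltnS.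
apply/subset_leq_card/fintype.subsetP => i; rewrite !inE.
move=> /andP[/andP[ia iA] iS]; rewrite ia iA iS orbT !andbT.
by apply: contraNneq bA => <-.
Qed.

Definition panhandle (r s n : nat) (r_gt0 : (0 < r)%N) (le_rs : (r <= s)%N)
    (lt_sn : (s < n)%N) : matroid 'I_n :=
  Matroid (panhandle_bases_neq0 r_gt0 le_rs lt_sn)
    (@panhandle_bases_exchange r s n).

(* Main.v *)
(** The lattice points of the [t]-th dilate are the integer points of [[0,t]^n]
with coordinate sum [t r] whose last [d = n - s] coordinates sum to at most
[t]: such a point is peeled off basis by basis.  Inclusion-exclusion, in the
form of Katzman's formula, turns their number into the coefficient of
[z^(r-1) y^(s-1)] in

  [(Phi'/Phi) / (1 - z Phi^t) * sum_(v <= t) C(v + d - 1, d - 1) Phi^(t - v)],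

where [Phi = (1 - y z) / (1 - y)].  The last sum is [C(t + d, d)] times the
integral of [d (1 - p)^(d - 1) Psi^t] over [p] in [[0,1]], with
[Psi = p Phi + 1 - p], so it suffices that
[K = (1 - z) Psi^t / (1 - z Phi^t)] expands positively in [y], [z], [t], [p]
and [1 - p].  Writing [log Psi = (1 - z) M] and [log Phi = (1 - z) (M + N)],
whose derivatives [mu] and [nu] (of [M] and [N]) have positive coefficients,
the series [alpha = (1 - z) / (1 - z Phi^t)] and [beta = alpha - (1 - z)]
satisfy [alpha' = beta' = t (mu + nu) alpha beta] and
[K' = t K (alpha mu + beta nu)], with constant terms [1], [z] and [1].  These
equations only involve positive terms, which gives the claim. *)
Require Import Defs.
From HB Require Import structures.
From mathcomp Require Import all_boot all_order all_algebra finmap.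
From mathcomp Require Import unstable boolp classical_sets functions
  cardinality.
From mathcomp Require Import reals convex interval_inference.
From mathcomp Require Import ring zify.
Set Implicit Arguments.
Unset Strict Implicit.
Unset Printing Implicit Defensive.
Import Order.TTheory GRing.Theory Num.Theory.
Local Open Scope ring_scope.

(** * Formal power series *)

(** A record rather than a bare function, so that the product can be convolution instead of the
    pointwise one. *)
Record series (A : Type) := Series { scoef : nat -> A }.

HB.instance Definition _ (A : Type) := gen_eqMixin (series A).
HB.instance Definition _ (A : Type) := gen_choiceMixin (series A).

Section SeriesRing.
Variable A : comNzRingType.
Implicit Types (f g h : series A) (n : nat).

Lemma seriesP f g : (forall n, scoef f n = scoef g n) -> f = g.
Proof. by case: f g => f [g] /= /funext ->. Qed.

Definition sadd f g := Series (fun n => scoef f n + scoef g n).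
Definition sopp f := Series (fun n => - scoef f n).
Definition szero : series A := Series (fun=> 0).
Definition sone : series A := Series (fun n => (n == 0)%:R).
Definition smul f g :=
  Series (fun n => \sum_(i < n.+1) scoef f i * scoef g (n - i)%N).

Fact saddA : associative sadd.
Proof. by move=> f g h; apply: seriesP => n /=; rewrite addrA. Qed.
Fact saddC : commutative sadd.
Proof. by move=> f g; apply: seriesP => n /=; rewrite addrC. Qed.
Fact sadd0 : left_id szero sadd.
Proof. by move=> f; apply: seriesP => n /=; rewrite add0r. Qed.
Fact saddN : left_inverse szero sopp sadd.
Proof. by move=> f; apply: seriesP => n /=; rewrite addNr. Qed.
HB.instance Definition _ :=
  GRing.isZmodule.Build (series A) saddA saddC sadd0 saddN.

Definition strunc n f : {poly A} := \poly_(i < n) scoef f i.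

Lemma coef_strunc n f i : (i < n)%N -> (strunc n f)`_i = scoef f i.
Proof. by rewrite coef_poly => ->. Qed.

(** Low coefficients of a product only see truncations, so the ring laws reduce to those of
    polynomials. *)
Lemma coef_smul_trunc n f g i : (i < n)%N ->
  scoef (smul f g) i = (strunc n f * strunc n g)`_i.
Proof.
move=> lt_in; rewrite coefM /=; apply: eq_bigr => j _.
by rewrite !coef_strunc //; have := ltn_ord j; lia.
Qed.

Fact smulC : commutative smul.
Proof.
move=> f g; apply: seriesP => n.
by rewrite !(coef_smul_trunc _ _ (ltnSn n)) mulrC.
Qed.
Fact smulA : associative smul.
Proof.
move=> f g h; apply: seriesP => n.
pose t := strunc n.+1.
(* Below degree [n.+1], truncating a product amounts to multiplying the truncations. *)
have E f1 f2 (q : {poly A}) : (t (smul f1 f2) * q)`_n = (t f1 * t f2 * q)`_n.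
  rewrite !coefM; apply: eq_bigr => i _.
  by rewrite coef_strunc // (coef_smul_trunc _ _ (ltn_ord i)).
rewrite !(coef_smul_trunc _ _ (ltnSn n)) E.
by rewrite mulrC E mulrC mulrA.
Qed.
Fact smul1 : left_id sone smul.
Proof.
move=> f; apply: seriesP => n /=; rewrite big_ord_recl /= mul1r subn0.
by rewrite big1 ?addr0 // => i _; rewrite mul0r.
Qed.
Fact smulDl : left_distributive smul sadd.
Proof.
move=> f g h; apply: seriesP => n /=.
by rewrite -big_split; apply: eq_bigr => i _; rewrite mulrDl.
Qed.
Fact sone_neq0 : sone != 0 :> series A.
Proof.
apply/eqP => /(congr1 (fun f => scoef f 0)) /= /eqP.
by rewrite oner_eq0.
Qed.
HB.instance Definition _ :=
  GRing.Zmodule_isComNzRing.Build (series A) smulA smulC smul1 smulDl sone_neq0.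

Lemma scoefD f g n : scoef (f + g) n = scoef f n + scoef g n. Proof. by []. Qed.
Lemma scoefN f n : scoef (- f) n = - scoef f n. Proof. by []. Qed.
Lemma scoefB f g n : scoef (f - g) n = scoef f n - scoef g n. Proof. by []. Qed.
Lemma scoef1 n : scoef (1 : series A) n = (n == 0)%:R. Proof. by []. Qed.
Lemma scoefM f g n :
  scoef (f * g) n = \sum_(i < n.+1) scoef f i * scoef g (n - i)%N.
Proof. by []. Qed.
Lemma scoefM0 f g : scoef (f * g) 0 = scoef f 0 * scoef g 0.
Proof. by rewrite scoefM big_ord_recl big_ord0 addr0. Qed.
Lemma scoef_sum I (r : seq I) (P : pred I) (F : I -> series A) n :
  scoef (\sum_(i <- r | P i) F i) n = \sum_(i <- r | P i) scoef (F i) n.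
Proof. by elim/big_rec2: _ => // i a b _ <-. Qed.

Definition sC (a : A) : series A := Series (fun n => if n is 0 then a else 0).
Definition sX : series A := Series (fun n => (n == 1)%:R).

Lemma scoefC a f n : scoef (sC a * f) n = a * scoef f n.
Proof.
rewrite scoefM big_ord_recl /= subn0 big1 ?addr0 // => i _.
by rewrite mul0r.
Qed.
Lemma sC_is_zmod_morphism : zmod_morphism sC.
Proof. by move=> a b; apply: seriesP => -[|n] //; rewrite scoefB subrr. Qed.
Lemma sC_is_monoid_morphism : monoid_morphism sC.
Proof.
split; first by apply: seriesP => -[].
by move=> a b; apply: seriesP => n; rewrite scoefC; case: n => //=;
  rewrite mulr0.
Qed.
HB.instance Definition _ :=
  GRing.isZmodMorphism.Build A (series A) sC sC_is_zmod_morphism.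
HB.instance Definition _ :=
  GRing.isMonoidMorphism.Build A (series A) sC sC_is_monoid_morphism.

Definition series_of_poly (p : {poly A}) : series A := Series (fun i => p`_i).
Lemma series_of_poly_is_zmod_morphism : zmod_morphism series_of_poly.
Proof. by move=> p q; apply: seriesP => n; rewrite scoefB /= coefB. Qed.
Lemma series_of_poly_is_monoid_morphism : monoid_morphism series_of_poly.
Proof.
split; first by apply: seriesP => n; rewrite scoef1 /= coef1.
by move=> p q; apply: seriesP => n; rewrite scoefM /= coefM.
Qed.
HB.instance Definition _ :=
  GRing.isZmodMorphism.Build {poly A} (series A) series_of_poly
    series_of_poly_is_zmod_morphism.
HB.instance Definition _ :=
  GRing.isMonoidMorphism.Build {poly A} (series A) series_of_poly
    series_of_poly_is_monoid_morphism.

Lemma scoefXn k f n :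
  scoef (sX ^+ k * f) n = if (k <= n)%N then scoef f (n - k)%N else 0.
Proof.
have -> : sX = series_of_poly 'X by apply: seriesP => i; rewrite /= coefX.
rewrite -rmorphXn scoefM /=.
case: leqP => [le_kn|lt_nk].
  rewrite (bigD1 (Ordinal (le_kn : (k < n.+1)%N))) //= coefXn eqxx mul1r.
  rewrite big1 ?addr0 // => i /eqP neq; rewrite coefXn.
  by case: eqP => [e|_]; rewrite ?mul0r //; case: neq; apply: val_inj.
rewrite big1 // => i _; rewrite coefXn.
by case: eqP => [e|_]; rewrite ?mul0r //; have := ltn_ord i; lia.
Qed.

Lemma scoefX f n : scoef (sX * f) n = if n is m.+1 then scoef f m else 0.
Proof.
rewrite -[sX]expr1 scoefXn.
by case: n => [|n] //=; rewrite subn1.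
Qed.

(** * Formal derivative *)

Definition sderiv f : series A := Series (fun n => scoef f n.+1 *+ n.+1).

Lemma coef_sderiv f n : scoef (sderiv f) n = scoef f n.+1 *+ n.+1.
Proof. by []. Qed.
Lemma sderivD f g : sderiv (f + g) = sderiv f + sderiv g.
Proof. by apply: seriesP => n; rewrite !(coef_sderiv, scoefD) mulrnDl. Qed.
Lemma sderivN f : sderiv (- f) = - sderiv f.
Proof. by apply: seriesP => n; rewrite !(coef_sderiv, scoefN) mulNrn. Qed.
Lemma sderivB f g : sderiv (f - g) = sderiv f - sderiv g.
Proof. by rewrite sderivD sderivN. Qed.
Lemma sderivC a : sderiv (sC a) = 0.
Proof. by apply: seriesP => n; rewrite coef_sderiv /= mul0rn. Qed.
Lemma sderiv1 : sderiv 1 = 0.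
Proof. by rewrite -(rmorph1 sC) sderivC. Qed.
Lemma sderivX : sderiv sX = 1.
Proof. by apply: seriesP => -[|n]; rewrite coef_sderiv //= mul0rn. Qed.
Lemma sderivM f g : sderiv (f * g) = sderiv f * g + f * sderiv g.
Proof.
(* The product rule comes from polynomials; coefficient [n] of a derivative reads degree [n.+1],
   hence the truncation at [n.+2]. *)
apply: seriesP => n; pose t := strunc n.+2.
have Dt h i : (i < n.+1)%N -> (t h)^`()`_i = scoef (sderiv h) i.
  by move=> lt_in; rewrite coef_deriv coef_strunc.
transitivity (t f * t g)^`()`_n.
  by rewrite coef_deriv -(coef_smul_trunc _ _ (ltnSn n.+1)).
rewrite derivM coefD !coefM scoefD !scoefM.
by congr (_ + _); apply: eq_bigr => i _; have lt_in := ltn_ord i;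
  rewrite Dt ?coef_strunc //; lia.
Qed.
Lemma sderivXn f k : sderiv (f ^+ k) = k%:R * f ^+ k.-1 * sderiv f.
Proof.
elim: k => [|k IHk]; first by rewrite sderiv1 !mul0r.
rewrite exprS sderivM IHk /=; case: k {IHk} => [|k] /=.
  by rewrite !expr0; ring.
by rewrite exprS; ring.
Qed.

Lemma scoefXg_exp_small g k n : (n < k)%N -> scoef ((sX * g) ^+ k) n = 0.
Proof. by rewrite exprMn scoefXn ltnNge => /negbTE ->. Qed.

(* [1 / (1 - X g)]. *)
Definition sgeo g : series A :=
  Series (fun n => scoef (\sum_(k < n.+1) (sX * g) ^+ k) n).

(** [(X g)^k] has no terms below degree [k], so one cutoff [N] serves all coefficients up to [N];
    the finite geometric sum then telescopes in [sgeoP]. *)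
Lemma coef_sgeo N g n : (n <= N)%N ->
  scoef (sgeo g) n = scoef (\sum_(k < N.+1) (sX * g) ^+ k) n.
Proof.
move=> le_nN; rewrite /= !scoef_sum.
rewrite (big_ord_widen N.+1 (fun k => scoef ((sX * g) ^+ k) n)) //.
rewrite [RHS](bigID (fun k : 'I_N.+1 => (k < n.+1)%N)) /=.
rewrite [X in _ = _ + X]big1 ?addr0 // => i.
by rewrite -leqNgt => lt_ni; rewrite scoefXg_exp_small.
Qed.

Lemma sgeoP g : sgeo g * (1 - sX * g) = 1.
Proof.
apply: seriesP => n.
have -> : scoef (sgeo g * (1 - sX * g)) n =
    scoef ((\sum_(k < n.+1) (sX * g) ^+ k) * (1 - sX * g)) n.
  rewrite !scoefM; apply: eq_bigr => i _.
  by rewrite (@coef_sgeo n) // -ltnS.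
rewrite mulrC -opprB mulNr -subrX1 opprB scoefB scoefXg_exp_small // subr0 //.
Qed.

Lemma scoef_sgeo0 g : scoef (sgeo g) 0 = 1.
Proof. by rewrite /= big_ord_recl big_ord0 expr0 addr0. Qed.

End SeriesRing.
Arguments sX {A}.
Arguments sC {A} a.

(** * The series alpha, beta and K *)

Section EulerianSeries.
Variables (A : idomainType) (z p : A) (t : nat).
Hypothesis z_neq1 : z != 1.

(** Makes the mixture [p Phi + 1 - p] a quotient of linear factors, as [p (1 - y z) + (1 - p) (1 -
    y) = 1 - y mixw]. *)
Definition mixw : A := 1 - p + p * z.
(* [1 / (1 - a y)]. *)
Definition invY (a : A) : series A := sgeo (sC a).
Definition PhiS : series A := (1 - sX * sC z) * invY 1.
Definition PsiS : series A := (1 - sX * sC mixw) * invY 1.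
(** [(1 - z) muS] and [(1 - z) lamS] are the logarithmic derivatives of [PsiS] and [PhiS]; [nuS] is
    [lamS - muS], free of subtraction once [1 - p] counts as a variable. *)
Definition muS : series A := sC p * invY 1 * invY mixw.
Definition nuS : series A := sC (1 - p) * invY mixw * invY z.
Definition lamS : series A := invY 1 * invY z.
(* [(1 - z) / (1 - z Phi^t)]: as [Phi - 1 = (1 - z) y / (1 - y)], the factor
   [1 - z] cancels and no division by it is needed. *)
Definition alphaS : series A :=
  sgeo (sC z * invY 1 * \sum_(i < t) PhiS ^+ i).
Definition KS : series A := alphaS * PsiS ^+ t.

Lemma invYP a : invY a * (1 - sX * sC a) = 1.
Proof. exact: sgeoP. Qed.

Lemma invY1P : invY 1 * (1 - sX) = 1.
Proof. by rewrite -[RHS](invYP 1) rmorph1 mulr1. Qed.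

Lemma sderiv_invY a : sderiv (invY a) = sC a * invY a ^+ 2.
Proof.
have /(congr1 (@sderiv A)) := invYP a.
rewrite sderivM sderivB sderivM sderivC sderiv1 sderivX => H.
have -> : sderiv (invY a) = sderiv (invY a) * (invY a * (1 - sX * sC a)).
  by rewrite invYP mulr1.
have -> : sC a * invY a ^+ 2 = invY a * (sderiv (invY a) * (1 - sX * sC a) +
    invY a * (0 - (1 * sC a + sX * 0))) + sC a * invY a ^+ 2.
  by rewrite H; ring.
by ring.
Qed.

Lemma sderiv_ratio a :
  sderiv ((1 - sX * sC a) * invY 1) = (1 - sC a) * invY 1 ^+ 2.
Proof.
rewrite sderivM sderiv_invY sderivB sderivM sderivC sderiv1 sderivX rmorph1.
have -> : (0 - (1 * sC a + sX * 0)) * invY 1 =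
   - sC a * invY 1 * (invY 1 * (1 - sX)) by rewrite invY1P; ring.
by ring.
Qed.

Lemma sderiv_Phi : sderiv PhiS = (1 - sC z) * lamS * PhiS.
Proof.
rewrite sderiv_ratio /lamS /PhiS.
have -> : (1 - sC z) * (invY 1 * invY z) * ((1 - sX * sC z) * invY 1) =
  (1 - sC z) * invY 1 ^+ 2 * (invY z * (1 - sX * sC z)) by ring.
by rewrite invYP mulr1.
Qed.

Lemma sderiv_Psi : sderiv PsiS = (1 - sC z) * muS * PsiS.
Proof.
rewrite sderiv_ratio /muS /PsiS.
have -> : (1 - sC z) * (sC p * invY 1 * invY mixw) *
    ((1 - sX * sC mixw) * invY 1) =
  (1 - sC z) * sC p * invY 1 ^+ 2 * (invY mixw * (1 - sX * sC mixw)) by ring.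
by rewrite invYP mulr1 /mixw rmorphD rmorphB rmorphM rmorph1; ring.
Qed.

Lemma muD_nu : muS + nuS = lamS.
Proof.
have -> : lamS = invY 1 * invY z * (invY mixw * (1 - sX * sC mixw)).
  by rewrite invYP mulr1.
have -> : invY 1 * invY z * (invY mixw * (1 - sX * sC mixw)) =
   sC p * invY 1 * invY mixw * (invY z * (1 - sX * sC z)) +
   sC (1 - p) * invY mixw * invY z * (invY 1 * (1 - sX)).
  by rewrite /mixw !(rmorphD, rmorphB, rmorphM, rmorph1); ring.
by rewrite invYP invY1P !mulr1.
Qed.

Lemma Psi_mix : PsiS = sC p * PhiS + sC (1 - p).
Proof.
rewrite -[sC (1 - p)]mulr1 -invY1P /PsiS /PhiS /mixw.
by rewrite !(rmorphD, rmorphB, rmorphM, rmorph1); ring.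
Qed.

Lemma Phi_sub1 : PhiS - 1 = sX * (1 - sC z) * invY 1.
Proof. by rewrite -[X in _ - X]invY1P /PhiS; ring. Qed.

(** This is [(1 - z Phi^t) / (1 - z)] with the division carried out. *)
Definition alphaD : series A :=
  1 - sX * (sC z * invY 1 * \sum_(i < t) PhiS ^+ i).

Lemma alphaDE : (1 - sC z) * alphaD = 1 - sC z * PhiS ^+ t.
Proof.
have := subrX1 PhiS t; rewrite Phi_sub1 /alphaD => H.
have -> : 1 - sC z * PhiS ^+ t = 1 - sC z - sC z * (PhiS ^+ t - 1) by ring.
by rewrite H; ring.
Qed.

Lemma alphaSP : alphaS * alphaD = 1. Proof. exact: sgeoP. Qed.

Lemma alpha_eq : alphaS * (1 - sC z * PhiS ^+ t) = 1 - sC z.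
Proof. by rewrite -alphaDE mulrCA alphaSP mulr1. Qed.

(** [1 - z] is not assumed to be a unit; it cancels because it acts on each coefficient as a nonzero
    scalar of a domain. *)
Lemma sCB1_inj (f g : series A) : (1 - sC z) * f = (1 - sC z) * g -> f = g.
Proof.
move=> E; apply: seriesP => n; have /(congr1 (fun h => scoef h n)) := E.
rewrite -(rmorph1 (@sC A)) -rmorphB !scoefC; apply: mulfI.
by rewrite subr_eq0 eq_sym.
Qed.

Lemma sderiv_Phi_exp x :
  sderiv (PhiS ^+ x) = x%:R * PhiS ^+ x * ((1 - sC z) * lamS).
Proof.
rewrite sderivXn sderiv_Phi; case: x => [|x]; first by rewrite !mul0r.
by rewrite /= exprS; ring.
Qed.

Lemma sderiv_Psi_exp x :
  sderiv (PsiS ^+ x) = x%:R * PsiS ^+ x * ((1 - sC z) * muS).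
Proof.
rewrite sderivXn sderiv_Psi; case: x => [|x]; first by rewrite !mul0r.
by rewrite /= exprS; ring.
Qed.

Lemma sderiv_alphaD :
  sderiv alphaD = - (sC z * t%:R * PhiS ^+ t * lamS).
Proof.
apply: sCB1_inj; have /(congr1 (@sderiv A)) := alphaDE.
rewrite sderivM !sderivB !sderiv1 !sderivM !sderivC sderiv_Phi_exp !subr0.
by rewrite !mul0r !add0r => ->; ring.
Qed.

Definition betaS : series A := alphaS - (1 - sC z).

Lemma betaE : betaS = alphaS * (sC z * PhiS ^+ t).
Proof. by rewrite /betaS -alpha_eq; ring. Qed.

(** Differentiating [alphaS * alphaD = 1] gives [alpha' = - alpha^2 alphaD'], in which [betaE]
    recognises a factor [beta]. *)
Lemma sderiv_alpha : sderiv alphaS = t%:R * (lamS * alphaS * betaS).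
Proof.
have /(congr1 (@sderiv A)) := alphaSP.
rewrite sderivM sderiv1 sderiv_alphaD => H.
have -> : sderiv alphaS = alphaS * (sderiv alphaS * alphaD).
  by rewrite mulrCA alphaSP mulr1.
rewrite (_ : sderiv alphaS * alphaD =
  alphaS * (sC z * t%:R * PhiS ^+ t * lamS)); last first.
  by apply/eqP; rewrite -subr_eq0 -[X in _ == X]H; apply/eqP; ring.
by rewrite betaE; ring.
Qed.

(** The logarithmic derivative of [KS] is [t (lam beta + (1 - z) mu)]; substituting
    [1 - z = alpha - beta] and [lam = mu + nu] removes the negative terms. *)
Lemma sderiv_K : sderiv KS = t%:R * (KS * (alphaS * muS + betaS * nuS)).
Proof.
rewrite /KS sderivM sderiv_alpha sderiv_Psi_exp -muD_nu.
rewrite (_ : alphaS * muS = betaS * muS + (1 - sC z) * muS).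
  by ring.
by rewrite /betaS; ring.
Qed.

Lemma scoef_exp0 (f : series A) k : scoef f 0 = 1 -> scoef (f ^+ k) 0 = 1.
Proof.
by move=> f0; elim: k => [|k IHk] //; rewrite exprS scoefM0 f0 IHk mulr1.
Qed.

Lemma scoef_alpha0 : scoef alphaS 0 = 1. Proof. exact: scoef_sgeo0. Qed.

Lemma scoef_Psi0 : scoef PsiS 0 = 1.
Proof. by rewrite scoefM0 scoef_sgeo0 scoefB scoefX subr0 mulr1. Qed.

Lemma scoef_K0 : scoef KS 0 = 1.
Proof. by rewrite scoefM0 scoef_alpha0 scoef_exp0 ?mulr1 ?scoef_Psi0. Qed.

(** The two series differ by the constant [1 - z], so [betaS] inherits positivity from [alphaS] in
    positive degrees. *)
Lemma scoef_beta n : scoef betaS n = if n is 0 then z else scoef alphaS n.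
Proof.
rewrite /betaS -(rmorph1 (@sC A)) -rmorphB scoefB; case: n => [|n];
  last exact: subr0.
by rewrite scoef_alpha0 /= subKr.
Qed.

(* Expansion of [1 / (1 - z Phi^t)] in powers of [z], with remainder. *)
Lemma lamK_expand r :
  lamS * KS = \sum_(a < r) (sC z) ^+ a * (PhiS ^+ (a * t) * ((1 - sC z) * lamS)
      * PsiS ^+ t) + (sC z) ^+ r * (PhiS ^+ (r * t) * (lamS * KS)).
Proof.
elim: r => [|r IHr]; first by rewrite big_ord0 !expr0 !mul1r add0r.
rewrite big_ord_recr /= -addrA {1}IHr; congr (_ + _).
rewrite mulSn [(t + _)%N]addnC exprD exprSr /KS.
rewrite -alpha_eq; ring.
Qed.

End EulerianSeries.

(** * Positivity *)

Section BetaFunctional.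
Variable e : nat.

(* The integral over [0,1] of [p^i (1 - p)^j] against the density
   [(e + 1) (1 - p)^e]; [beta_int] integrates a polynomial in [p]. *)
Definition beta_weight (i j : nat) : rat :=
  (e.+1 * i`! * (j + e)`!)%N%:R / (e + i + j).+1`!%:R.

Definition beta_int (f : {poly rat}) : rat :=
  \sum_(i < size f) f`_i * beta_weight i 0.

Lemma beta_int_widen n (f : {poly rat}) : (size f <= n)%N ->
  beta_int f = \sum_(i < n) f`_i * beta_weight i 0.
Proof.
move=> le_fn; rewrite /beta_int
  (big_ord_widen n (fun i => f`_i * beta_weight i 0)) //.
rewrite [RHS](bigID (fun i : 'I_n => (i < size f)%N)) /= [X in _ + X]big1
  ?addr0 //.
by move=> i; rewrite -leqNgt => /(nth_default 0) ->; rewrite mul0r.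
Qed.

Lemma beta_int_is_linear : scalar beta_int.
Proof.
move=> a f g; pose n := maxn (size f) (size g).
have sf : (size f <= n)%N := leq_maxl _ _.
have sg : (size g <= n)%N := leq_maxr _ _.
have sfg : (size (a *: f + g)%R <= n)%N.
  by rewrite (leq_trans (size_polyD _ _)) // geq_max sg (leq_trans
    (size_scale_leq _ _)).
rewrite !(@beta_int_widen n) // mulr_sumr -big_split /=.
by apply: eq_bigr => i _; rewrite coefD coefZ mulrDl -mulrA.
Qed.
HB.instance Definition _ :=
  GRing.isLinear.Build rat {poly rat} rat *%R beta_int beta_int_is_linear.

Lemma beta_intZ a f : beta_int (a *: f) = a * beta_int f.
Proof. exact: linearZ. Qed.

Lemma beta_weightS i j :
  beta_weight i j.+1 = beta_weight i j - beta_weight i.+1 j.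
Proof.
rewrite /beta_weight !(addnS, addSn) !factS !natrM.
have f0 : (e + i + j)`!%:R != 0 :> rat by rewrite pnatr_eq0 -lt0n fact_gt0.
have n0 (k : nat) : k.+1%:R != 0 :> rat by rewrite pnatr_eq0.
rewrite !(natrD, =^~natr1) in n0 *.
have n1 := n0 (e + i + j)%N; have n2 := n0 (e + i + j).+1.
rewrite -!natr1 !natrD in n1 n2.
by field; rewrite f0 n1 n2.
Qed.

(** [beta_int] is defined on powers of [p]; factors [1 - p] are reached by induction, as [p^i (1 -
    p)^j - p^(i+1) (1 - p)^j = p^i (1 - p)^(j+1)] and the weights obey the same recurrence. *)
Lemma beta_int_bernstein i j :
  beta_int ('X^i * (1 - 'X) ^+ j) = beta_weight i j.
Proof.
elim: j i => [|j IHj] i.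
  rewrite expr0 mulr1 (@beta_int_widen i.+1) ?size_polyXn //.
  rewrite big_ord_recr /= coefXn eqxx mul1r big1 ?add0r // => k _.
  by rewrite coefXn ltn_eqF ?mul0r.
rewrite beta_weightS -!IHj -raddfB exprSr exprS; congr beta_int; ring.
Qed.

Lemma beta_weight_ge0 i j : 0 <= beta_weight i j.
Proof. by rewrite divr_ge0 ?ler0n. Qed.

(* The outer variable is [z], the inner one is [p].  Nonnegativity of the
   integral is not multiplicative; taking for [cone] the multipliers that
   preserve [bern_nonneg] makes closure under products automatic. *)
Definition bern_nonneg (g : {poly {poly rat}}) : Prop :=
  forall k i j, 0 <= beta_int (g`_k * ('X^i * (1 - 'X) ^+ j)).

Definition cone (f : {poly {poly rat}}) : Prop :=
  forall g, bern_nonneg g -> bern_nonneg (f * g).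

Lemma bern_nonneg1 : bern_nonneg 1.
Proof.
move=> k i j; rewrite coef1; case: eqP => _; last by rewrite mul0r raddf0.
by rewrite mul1r beta_int_bernstein beta_weight_ge0.
Qed.

Lemma cone_beta_int f k : cone f -> 0 <= beta_int f`_k.
Proof.
by move=> /(_ _ bern_nonneg1 k 0 0)%N; rewrite !expr0 !mulr1.
Qed.

Lemma coneD f g : cone f -> cone g -> cone (f + g).
Proof.
move=> cf cg h ph k i j; rewrite mulrDl coefD mulrDl raddfD.
by rewrite addr_ge0 ?cf ?cg.
Qed.
Lemma cone0 : cone 0.
Proof. by move=> h ph k i j; rewrite mul0r coef0 mul0r raddf0. Qed.
Lemma coneM f g : cone f -> cone g -> cone (f * g).
Proof. by move=> cf cg h ph; rewrite -mulrA; apply/cf/cg. Qed.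
Lemma cone1 : cone 1. Proof. by move=> h ph; rewrite mul1r. Qed.
Lemma cone_const (a : rat) : 0 <= a -> cone a%:P%:P.
Proof.
move=> a0 h ph k i j; rewrite coefCM mul_polyC -scalerAl linearZ /=.
by rewrite mulr_ge0.
Qed.
Lemma coneX : cone 'X.
Proof.
move=> h ph [|k] i j; rewrite coefXM //=.
by rewrite mul0r raddf0.
Qed.
Lemma cone_p : cone 'X%:P.
Proof.
move=> h ph k i j; rewrite coefCM.
have := ph k i.+1 j; rewrite exprS; congr (0 <= beta_int _); ring.
Qed.
Lemma cone_1p : cone (1 - 'X%:P).
Proof.
move=> h ph k i j; rewrite -(rmorph1 polyC) -rmorphB coefCM.
have := ph k i j.+1; rewrite exprS; congr (0 <= beta_int _); ring.
Qed.
Lemma cone_sum I (r : seq I) (P : pred I) F :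
  (forall i, P i -> cone (F i)) -> cone (\sum_(i <- r | P i) F i).
Proof. by move=> cF; apply: big_ind => //; [exact: cone0|exact: coneD]. Qed.

(** The series are given separately for each natural [t]; being the values of one polynomial in [t]
    is part of what has to be propagated. *)
Definition tpos (f : nat -> {poly {poly rat}}) : Prop :=
  exists2 h : {poly {poly {poly rat}}}, (forall m, cone h`_m) &
    forall t, f t = h.[t%:R].

Lemma tposD f g : tpos f -> tpos g -> tpos (fun t => f t + g t).
Proof.
move=> [h ch fh] [k ck gk]; exists (h + k) => [m|t].
  by rewrite coefD; apply: coneD.
by rewrite hornerD fh gk.
Qed.
Lemma tposM f g : tpos f -> tpos g -> tpos (fun t => f t * g t).
Proof.
move=> [h ch fh] [k ck gk]; exists (h * k) => [m|t].
  by rewrite coefM; apply: cone_sum => i _; apply: coneM.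
by rewrite hornerM fh gk.
Qed.
Lemma tposC a : cone a -> tpos (fun=> a).
Proof.
move=> ca; exists a%:P => [m|t]; last by rewrite hornerC.
by rewrite coefC; case: eqP => // _; apply: cone0.
Qed.
Lemma tpos_id : tpos (fun t => t%:R).
Proof.
exists 'X => [m|t]; last by rewrite hornerX.
by rewrite coefX; case: eqP => _; [apply: cone1|apply: cone0].
Qed.
Lemma tpos_ext f g : f =1 g -> tpos f -> tpos g.
Proof. by move=> fg [h ch fh]; exists h => // t; rewrite -fg. Qed.
Lemma tpos_sum n (F : 'I_n -> nat -> {poly {poly rat}}) :
  (forall i, tpos (F i)) -> tpos (fun t => \sum_(i < n) F i t).
Proof.
elim: n F => [|n IHn] F pF.
  by apply: tpos_ext (tposC cone0) => t; rewrite big_ord0.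
have := tposD (pF ord0) (IHn (fun i => F (lift ord0 i)) (fun i => pF _)).
by apply: tpos_ext => t; rewrite big_ord_recl.
Qed.
Lemma tpos_divS n f : tpos (fun t => f t *+ n.+1) -> tpos f.
Proof.
pose c : {poly {poly rat}} := (n.+1%:R^-1)%:P%:P.
have cc : cone c by apply: cone_const; rewrite invr_ge0 ler0n.
move=> /(tposM (tposC cc)); apply: tpos_ext => t.
rewrite -mulr_natl mulrA -(rmorph_nat polyC) -(rmorph_nat polyC).
by rewrite -!rmorphM mulVf ?pnatr_eq0 // mul1r.
Qed.

(** The bound serves the induction along the differential equations, where degree [N.+1] depends on
    degrees up to [N]. *)
Definition tpos_upto N (F : nat -> series {poly {poly rat}}) : Prop :=
  forall n, (n <= N)%N -> tpos (fun t => scoef (F t) n).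

Lemma tpos_uptoM N F G : tpos_upto N F -> tpos_upto N G ->
  tpos_upto N (fun t => F t * G t).
Proof.
move=> pF pG n le_nN; apply: tpos_sum => i.
have lt_in := ltn_ord i.
by apply: tposM; [apply: pF|apply: pG]; lia.
Qed.
Lemma tpos_uptoD N F G : tpos_upto N F -> tpos_upto N G ->
  tpos_upto N (fun t => F t + G t).
Proof. by move=> pF pG n le_nN; apply: tposD; [apply: pF|apply: pG]. Qed.
Lemma tpos_upto_const N (f : series _) :
  (forall n, cone (scoef f n)) -> tpos_upto N (fun=> f).
Proof. by move=> cf n _; apply: tposC. Qed.

Lemma cone_scoefM (f g : series _) : (forall n, cone (scoef f n)) ->
  (forall n, cone (scoef g n)) -> forall n, cone (scoef (f * g) n).
Proof. by move=> cf cg n; apply: cone_sum => i _; apply: coneM. Qed.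

Lemma cone_sC a : cone a -> forall n, cone (scoef (sC a) n).
Proof. by move=> ca [|n] //; apply: cone0. Qed.

Lemma cone_invY a : cone a -> forall n, cone (scoef (invY a) n).
Proof.
move=> ca n; rewrite /invY /= scoef_sum; apply: cone_sum => k _.
move: (nat_of_ord k) => m {k}; elim: m n => [|m IHm] n.
  by rewrite expr0 scoef1; case: eqP => _; [apply: cone1|apply: cone0].
rewrite exprS; apply: cone_scoefM => // {}n.
rewrite scoefX; case: n => [|n]; first exact: cone0.
exact: cone_sC.
Qed.

(** * Positivity of alpha, beta and K *)

Local Notation z := ('X : {poly {poly rat}}).
Local Notation p := ('X%:P : {poly {poly rat}}).

Lemma X_neq1 : z != 1.
Proof.
apply/eqP => /(congr1 (fun q : {poly {poly rat}} => q`_1)) /eqP.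
by rewrite coefX coef1 oner_eq0.
Qed.

Lemma cone_mixw : cone (mixw z p).
Proof. exact: coneD cone_1p (coneM cone_p coneX). Qed.

Lemma cone_mu n : cone (scoef (muS z p) n).
Proof.
by do 2?[apply: cone_scoefM => {}n]; first exact: cone_sC cone_p n;
  apply: cone_invY; [exact: cone1|exact: cone_mixw].
Qed.
Lemma cone_nu n : cone (scoef (nuS z p) n).
Proof.
by do 2?[apply: cone_scoefM => {}n]; first exact: cone_sC cone_1p n;
  apply: cone_invY; [exact: cone_mixw|exact: coneX].
Qed.
Lemma cone_lam n : cone (scoef (lamS z) n).
Proof.
by apply: cone_scoefM => {}n; apply: cone_invY; [exact: cone1|exact: coneX].
Qed.

Lemma tpos_beta N : tpos_upto N (alphaS z) -> tpos_upto N (betaS z).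
Proof.
move=> pa [|n] le_nN.
  by apply: tpos_ext (tposC coneX) => t; rewrite scoef_beta.
by apply: tpos_ext (pa _ le_nN) => t; rewrite scoef_beta.
Qed.

(** On coefficients the equation reads [(n + 1) F_(n+1) = t G_n], and division by [n.+1] preserves
    positivity. *)
Lemma tpos_ode n F G : (forall t, sderiv (F t) = t%:R * G t) ->
  tpos_upto n G -> tpos (fun t => scoef (F t) n.+1).
Proof.
move=> FG pG; apply: (@tpos_divS n).
apply: tpos_ext (tposM tpos_id (pG n (leqnn n))) => t.
by rewrite -coef_sderiv FG -(rmorph_nat (@sC _)) scoefC.
Qed.

Lemma tpos_alpha N : tpos_upto N (alphaS z).
Proof.
elim: N => [|N IHN] n; first by case: n => // _;
  apply: tpos_ext (tposC cone1) => t; rewrite scoef_alpha0.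
rewrite leq_eqVlt => /predU1P[->|/IHN //].
apply: tpos_ode (fun t => sderiv_alpha t X_neq1) _.
apply: tpos_uptoM (tpos_beta IHN); apply: tpos_uptoM IHN.
by apply: tpos_upto_const; apply: cone_lam.
Qed.

Lemma tpos_K N : tpos_upto N (KS z p).
Proof.
elim: N => [|N IHN] n; first by case: n => // _;
  apply: tpos_ext (tposC cone1) => t; rewrite scoef_K0.
rewrite leq_eqVlt => /predU1P[->|/IHN //].
apply: tpos_ode (fun t => sderiv_K p t X_neq1) _.
have pa := @tpos_alpha N.
apply: tpos_uptoM IHN _; apply: tpos_uptoD.
  by apply: tpos_uptoM pa _; apply: tpos_upto_const; apply: cone_mu.
by apply: tpos_uptoM (tpos_beta pa) _; apply: tpos_upto_const; apply: cone_nu.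
Qed.

Lemma beta_int_lamK_poly N k : exists2 q : {poly rat}, (forall m, 0 <= q`_m) &
  forall t, q.[t%:R] = beta_int (scoef (lamS z * KS z p t) N)`_k.
Proof.
have [|h ch hE] := @tpos_uptoM N (fun=> lamS z) (KS z p) _ (@tpos_K N)
  N (leqnn N).
  by apply: tpos_upto_const; apply: cone_lam.
(* Reading off [z^k] and integrating over [p] are linear over the rationals, hence can be done on
   each coefficient of [h], a polynomial in [t]. *)
exists (\poly_(m < size h) beta_int (h`_m)`_k) => [m|t].
  by rewrite coef_poly; case: ifP => // _; apply: cone_beta_int.
rewrite horner_poly hE horner_coef coef_sum raddf_sum; apply: eq_bigr => m _.
have -> : t%:R ^+ m = (t%:R ^+ m)%:P%:P :> {poly {poly rat}}.
  by rewrite !rmorphXn !rmorph_nat.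
rewrite coefMC [h`_m`_k * _]mulrC mul_polyC.
by rewrite [RHS]linearZ mulrC.
Qed.

End BetaFunctional.

(** * Katzman coefficients *)

Section SeriesCoefficients.
Variable A : idomainType.

Lemma scoef_invY (a : A) n : scoef (invY a) n = a ^+ n.
Proof.
elim: n => [|n IHn]; first by rewrite scoef_sgeo0.
have /(congr1 (fun f => scoef f n.+1)) := invYP a.
rewrite mulrBr mulr1 mulrCA scoefB scoefX mulrC scoefC IHn scoef1 exprS /=.
by move/eqP; rewrite subr_eq0 => /eqP.
Qed.

Lemma scoef_inv1_exp m n :
  scoef ((invY 1 : series A) ^+ m.+1) n = 'C(n + m, m)%:R.
Proof.
elim: m n => [|m IHm] n; first by rewrite expr1 scoef_invY expr1n addn0 bin0.
rewrite exprSr scoefM.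
under eq_bigr => i _ do rewrite IHm scoef_invY expr1n mulr1.
(* What remains is the hockey-stick identity for binomial coefficients. *)
rewrite -natr_sum; congr _%:R; elim: n => [|n IHn].
  by rewrite big_ord_recl big_ord0 !add0n !binn.
rewrite big_ord_recr /= IHn !addnS addSn [RHS]binS addnC; congr (_ + _)%N.
Qed.

Lemma scoef_powM m (a : A) x f n :
  scoef ((1 - sX ^+ m * sC a) ^+ x * f) n =
  \sum_(i < x.+1) if (m * i <= n)%N
    then (-1) ^+ i * 'C(x, i)%:R * a ^+ i * scoef f (n - m * i)%N else 0.
Proof.
rewrite exprBn mulr_suml scoef_sum; apply: eq_bigr => i _.
rewrite expr1n mulr1 exprMn -exprM -rmorphXn.
have -> : ((-1) ^+ i * (sX ^+ (m * i) * sC (a ^+ i))) *+ 'C(x, i) * f =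
    sX ^+ (m * i) * (sC ((-1) ^+ i * 'C(x, i)%:R * a ^+ i) * f).
  rewrite !rmorphM rmorph_nat rmorph_sign -mulr_natl; ring.
by rewrite scoefXn scoefC.
Qed.

End SeriesCoefficients.

Lemma natr_bin (i j : nat) :
  'C(i + j, j)%:R = (i + j)`!%:R / (i`!%:R * j`!%:R) :> rat.
Proof.
have f0 k : k`!%:R != 0 :> rat by rewrite pnatr_eq0 -lt0n fact_gt0.
have := bin_fact (leq_addl i j); rewrite addnK => <-.
by rewrite !natrM; field; rewrite !f0.
Qed.

(** Both sides are [(i + k) (i + j + 1) (i + j + k)! / (i! (j + 1)! k!)]. In [coef_Phi_lam] this
    matches a coefficient of [Phi^(i+k)] with a Katzman coefficient. *)
Lemma bin_swap i j k : (0 < i + k)%N ->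
  ((i + k) * ('C(j.+1 + i, i) * 'C(k + (i + j), i + j)) =
   (i + j).+1 * ('C(k + i, i) * 'C(j.+1 + (i + k).-1, (i + k).-1)))%N.
Proof.
case E : (i + k)%N => [//|x] _ /=; apply/eqP; rewrite -(@eqr_nat rat) !natrM.
have f0 m : m`!%:R != 0 :> rat by rewrite pnatr_eq0 -lt0n fact_gt0.
have n0 m : m.+1%:R != 0 :> rat by rewrite pnatr_eq0.
rewrite !natr_bin.
have -> : (k + (i + j) = j.+1 + x)%N by lia.
have -> : (k + i = x.+1)%N by lia.
have -> : (j.+1 + i = (i + j).+1)%N by lia.
rewrite !(factS (i + j)) !(factS x) !(natrM _ (i + j).+1) !(natrM _ x.+1).
by apply/eqP; field; rewrite !f0.
Qed.

Section Katzman.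
Local Notation z := ('X : {poly {poly rat}}).
Local Notation p := ('X%:P : {poly {poly rat}}).

(* Coefficient of [z^i q^x] in [((1 - z q) / (1 - q))^(S + 1)].  The truncated
   subtraction is harmless for [i <= S]: the binomial is [0] when [x < i]. *)
Definition katzman_coef (S i x : nat) : rat :=
  (-1) ^+ i * 'C(S.+1, i)%:R * 'C(x + S - i, S)%:R.

(** Partial fractions, for the exponent [x = 0] of [coef_Phi_lam], which differentiation of [Phi^x]
    does not reach. *)
Lemma lam_split : (1 - sC z) * lamS z = invY 1 - sC z * invY z.
Proof.
have -> : invY 1 - sC z * invY z = invY 1 * (invY z * (1 - sX * sC z)) -
  sC z * invY z * (invY 1 * (1 - sX)) by rewrite invYP invY1P; ring.
by rewrite /lamS; ring.
Qed.

Lemma coef_Phi_exp x n i : (i <= n)%N ->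
  (scoef (PhiS z ^+ x.+1) n)`_i =
  ((-1) ^+ i * 'C(x.+1, i)%:R * 'C(n - i + x, x)%:R)%:P.
Proof.
move=> le_in; rewrite /PhiS exprMn -[sX]expr1 scoef_powM coef_sum.
(* Each summand is a constant times [z^j], so only [j = i] contributes to [z^i]. *)
have E (j : nat) : (j <= n)%N ->
  (if (1 * j <= n)%N then (-1) ^+ j * 'C(x.+1, j)%:R * z ^+ j *
     scoef (invY 1 ^+ x.+1) (n - 1 * j) else 0)`_i =
  if j == i then ((-1) ^+ i * 'C(x.+1, i)%:R * 'C(n - i + x, x)%:R)%:P else 0.
  move=> le_jn; rewrite mul1n le_jn scoef_inv1_exp.
  have -> : (-1) ^+ j * 'C(x.+1, j)%:R * z ^+ j * 'C(n - j + x, x)%:R =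
    ((-1) ^+ j * 'C(x.+1, j)%:R * 'C(n - j + x, x)%:R)%:P%:P * z ^+ j.
    by rewrite !rmorphM !rmorph_nat !rmorph_sign; ring.
  rewrite coefCM coefXn eq_sym; case: eqP => [->|_]; first by rewrite mulr1.
  by rewrite mulr0.
have Z (j : nat) : (n < j)%N ->
  (if (1 * j <= n)%N then (-1) ^+ j * 'C(x.+1, j)%:R * z ^+ j *
     scoef (invY 1 ^+ x.+1) (n - 1 * j) else 0)`_i = 0.
  by rewrite mul1n ltnNge => /negbTE ->; rewrite coef0.
have [le_ix|lt_xi] := leqP i x.+1; last first.
  rewrite bin_small // mulr0 mul0r big1 // => j _.
  have [le_jn|/Z ->//] := leqP j n; rewrite E //.
  by case: eqP => // ji; have := ltn_ord j; rewrite ji; lia.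
rewrite (bigD1 (Ordinal (le_ix : (i < x.+2)%N))) //= E // eqxx big1 ?addr0 //.
move=> j /eqP ji; have [le_jn|/Z ->//] := leqP j n; rewrite E //.
by case: eqP => // ij; case: ji; apply: val_inj.
Qed.

(** For [x > 0], [Phi^x (1 - z) lam] is [(Phi^x)' / x], so its coefficient at [y^S] is [(S + 1) / x]
    times that of [Phi^x] at [y^(S+1)]. *)
Lemma coef_Phi_lam S i x : (i <= S)%N ->
  (scoef (PhiS z ^+ x * ((1 - sC z) * lamS z)) S)`_i = (katzman_coef S i x)%:P.
Proof.
move=> le_iS; case: x => [|x].
  rewrite mul1r lam_split scoefB scoefC !scoef_invY expr1n -exprS coefB coef1
    coefXn.
  rewrite (ltn_eqF (le_iS : (i < S.+1)%N)) subr0 /katzman_coef add0n.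
  case: i le_iS => [|i] le_iS; first by rewrite subn0 bin0 binn expr0 !mul1r.
  by rewrite (_ : 'C(S - i.+1, S) = 0%N) ?mulr0 // bin_small //; lia.
have x0 : x.+1%:R%:P != 0 :> {poly rat} by rewrite polyC_eq0 pnatr_eq0.
apply: (mulfI x0); have /(congr1 (fun f : series {poly {poly rat}} =>
  (scoef f S)`_i)) := sderiv_Phi_exp z x.+1.
rewrite coef_sderiv coefMn coef_Phi_exp ?(leqW le_iS) // => H.
have -> : x.+1%:R%:P * (scoef (PhiS z ^+ x.+1 * ((1 - sC z) * lamS z)) S)`_i =
   (scoef (x.+1%:R * PhiS z ^+ x.+1 * ((1 - sC z) * lamS z)) S)`_i.
  by rewrite -[in RHS]mulrA -[in RHS](rmorph_nat (@sC _)) scoefC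
    -[in RHS](rmorph_nat polyC) coefCM rmorph_nat.
rewrite -{}H -rmorphMn -rmorphM; congr _%:P; rewrite /katzman_coef.
have [le_ix|lt_xi] := leqP i x.+1; last first.
  rewrite (@bin_small x.+1 i) // (@bin_small (x.+1 + S - i) S); last by lia.
  by rewrite !(mulr0, mul0r, mul0rn).
have := @bin_swap i (S - i) (x.+1 - i).
rewrite subnKC // subnKC // subnK // => /(_ isT).
rewrite -subSn // subnK ?(leqW le_iS) //= => /(congr1 (fun m => m%:R : rat)).
rewrite (_ : (x.+1 - i + S = x.+1 + S - i)%N); last by lia.
rewrite !natrM => H.
by rewrite -mulr_natl -!mulrA mulrCA -H mulrCA.
Qed.

(** Turns the integral of the binomial term [C(t, u) p^u (1 - p)^(t-u)] into the number of ways to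
    write [t - u] as a sum of [e.+1] naturals, the tail coordinates of a lattice point. *)
Lemma beta_weight_bin e t u : (u <= t)%N ->
  'C(t + e.+1, e.+1)%:R * ('C(t, u)%:R * beta_weight e u (t - u)) =
  'C(t - u + e, e)%:R.
Proof.
move=> le_ut; rewrite /beta_weight -{2}(subnK le_ut) !natr_bin.
rewrite (_ : (e + u + (t - u)).+1 = (t + e.+1)%N); last by lia.
have f0 m : m`!%:R != 0 :> rat by rewrite pnatr_eq0 -lt0n fact_gt0.
have n0 : e.+1%:R != 0 :> rat by rewrite pnatr_eq0.
rewrite subnK // (natrM _ (e.+1 * _)%N) (natrM _ e.+1 u`!) (factS e)
  (natrM _ e.+1 e`!).
by field; rewrite !f0 nat1r n0.
Qed.

Lemma beta_int_lamK e S r t : (r < S.+1)%N ->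
  'C(t + e.+1, e.+1)%:R * beta_int e (scoef (lamS z * KS z p t) S)`_r =
  \sum_(a < r.+1) \sum_(u < t.+1)
    'C(t - u + e, e)%:R * katzman_coef S (r - a) (a * t + u).
Proof.
(* The remainder of the expansion carries [z^(r+1)] and does not reach [z^r]. *)
move=> lt_rS; rewrite (lamK_expand z p t r.+1) scoefD coefD.
rewrite -[sC z ^+ r.+1]rmorphXn scoefC coefXnM ltnSn addr0.
rewrite scoef_sum coef_sum raddf_sum mulr_sumr; apply: eq_bigr => a _.
rewrite -rmorphXn scoefC coefXnM (_ : (r < a)%N = false);
  last by have := ltn_ord a; lia.
(* [Psi^t = (p Phi + 1 - p)^t] is expanded by the binomial theorem; [u] is the power of [p Phi]. *)
rewrite Psi_mix [sC p * _ + _]addrC exprDn [PhiS z ^+ _ * _ * _]mulr_sumr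
  scoef_sum coef_sum raddf_sum mulr_sumr.
apply: eq_bigr => u _.
have le_ut : (u <= t)%N by rewrite -ltnS.
have -> : PhiS z ^+ (a * t) * ((1 - sC z) * lamS z) *
    ((sC (1 - p) ^+ (t - u) * (sC p * PhiS z) ^+ u) *+ 'C(t, u)) =
  sC (('C(t, u)%:R * ('X ^+ u * (1 - 'X) ^+ (t - u)))%:P) *
    (PhiS z ^+ (a * t + u) * ((1 - sC z) * lamS z)).
  move: (PhiS z) ((1 - sC z) * lamS z) => F L.
  rewrite -mulr_natl exprMn exprD !rmorphM !rmorphXn !rmorph_nat !rmorphB.
  by rewrite !rmorph1 /=; ring.
rewrite scoefC coefCM coef_Phi_lam; last by lia.
have -> (B : {poly rat}) (b : rat) :
    'C(t, u)%:R * B * b%:P = (b * 'C(t, u)%:R) *: B.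
  by rewrite -mul_polyC rmorphM rmorph_nat; ring.
rewrite [X in _ * X]beta_intZ.
rewrite beta_int_bernstein -(beta_weight_bin e le_ut).
by ring.
Qed.

Lemma katzman_sum_poly e S r : (r < S.+1)%N ->
  exists2 q : {poly rat}, (forall m, 0 <= q`_m) &
  forall t, q.[t%:R] = \sum_(a < r.+1) \sum_(u < t.+1)
    'C(t - u + e, e)%:R * katzman_coef S (r - a) (a * t + u).
Proof.
move=> lt_rS; have [q q0 qE] := beta_int_lamK_poly e S r.
have M (f g : {poly rat}) : (forall m, 0 <= f`_m) -> (forall m, 0 <= g`_m) ->
    forall m, 0 <= (f * g)`_m.
  by move=> f0 g0 m; rewrite coefM sumr_ge0 // => i _; rewrite mulr_ge0.
(* The factor in front of the integral is the product of the [(t + i) / i] for [1 <= i <= e + 1], a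
   polynomial in [t] with nonnegative coefficients. *)
have [b b0 bE] : exists2 b : {poly rat}, (forall m, 0 <= b`_m) &
    forall t, b.[t%:R] = 'C(t + e.+1, e.+1)%:R.
  elim: e.+1 => [|d [b b0 bE]].
    exists 1 => [m|t]; last by rewrite hornerC bin0.
    by rewrite coef1; case: eqP.
  exists (b * (d.+1%:R^-1 *: ('X + d.+1%:R%:P))).
    apply: M => // m; rewrite coefZ coefD coefX coefC mulr_ge0 ?invr_ge0
      ?ler0n //.
    by rewrite addr_ge0 //; case: eqP.
  move=> t; rewrite hornerM hornerZ hornerD hornerX hornerC bE;
    apply: (@mulfI _ d.+1%:R); first by rewrite pnatr_eq0.
  have := mul_bin_diag (t + d).+1 d => /(congr1 (fun m => m%:R : rat)).
  rewrite !natrM addnS /= => <-; rewrite -addnS natrD.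
  by rewrite [X in _ * X]mulrCA mulVKf ?pnatr_eq0 // mulrC.
exists (b * q); first exact: M.
by move=> t; rewrite hornerM bE qE beta_int_lamK.
Qed.

End Katzman.

(** * Counting points of a box with prescribed sums *)

Definition box_poly (t : nat) : {poly rat} := \sum_(k < t.+1) 'X^k.

(** Inclusion-exclusion: [box_poly t] is [(1 - X^(t+1)) / (1 - X)], and [i] counts the coordinates
    forced above [t]. *)
Lemma coef_box_poly_exp t m k : (box_poly t ^+ m.+1)`_k =
  \sum_(i < m.+2) if (t.+1 * i <= k)%N
    then (-1) ^+ i * 'C(m.+1, i)%:R * 'C(k - t.+1 * i + m, m)%:R else 0.
Proof.
have -> :
    (box_poly t ^+ m.+1)`_k = scoef (series_of_poly (box_poly t) ^+ m.+1) k.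
  by rewrite -rmorphXn.
have -> : series_of_poly (box_poly t) = (1 - sX ^+ t.+1 * sC 1) * invY 1.
  have Xn : series_of_poly 'X = sX :> series rat.
    by apply: seriesP => i; rewrite /= coefX.
  rewrite rmorph1 mulr1 -[RHS]mulrC -opprB subrX1.
  have -> : \sum_(i < t.+1) sX ^+ i = series_of_poly (box_poly t) :> series rat.
    by rewrite rmorph_sum; apply: eq_bigr => i _; rewrite -Xn rmorphXn.
  rewrite -[LHS]mul1r -[in LHS](invY1P rat); ring.
rewrite exprMn scoef_powM; apply: eq_bigr => i _.
by rewrite scoef_inv1_exp expr1n mulr1.
Qed.

Lemma coef_box_poly_small t m k : (k <= t)%N ->
  (box_poly t ^+ m.+1)`_k = 'C(k + m, m)%:R.
Proof.
move=> le_kt; rewrite coef_box_poly_exp big_ord_recl muln0 leq0n subn0.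
rewrite expr0 bin0 !mul1r big1 ?addr0 // => i _; rewrite /= /bump /=.
by rewrite ifF //; apply/negbTE; rewrite -ltnNge; nia.
Qed.

(** With [a = r - i], the exponent [t r + u - (t + 1) i] is [a t + u - i]; it is negative for
    [i > r] because [u <= t]. *)
Lemma coef_box_poly_katzman t r S u : (r <= S)%N -> (u <= t)%N ->
  (box_poly t ^+ S.+1)`_(t * r + u) =
  \sum_(a < r.+1) katzman_coef S (r - a) (a * t + u).
Proof.
move=> le_rS le_ut; rewrite coef_box_poly_exp.
rewrite [RHS](reindex_inj rev_ord_inj) /=.
rewrite (bigID (fun i : 'I_S.+2 => (i < r.+1)%N)) /= [X in _ + X]big1 ?addr0;
  last first.
  by move=> i; rewrite -leqNgt => lt_ri; rewrite ifF //; apply/negbTE; nia.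
rewrite -(big_ord_widen S.+2 (fun i => if (t.+1 * i <= t * r + u)%N then
   (-1) ^+ i * 'C(S.+1, i)%:R * 'C(t * r + u - t.+1 * i + S, S)%:R else 0));
     last by lia.
apply: eq_bigr => i _; have := ltn_ord i; rewrite ltnS => le_ir.
rewrite /katzman_coef subSS subKn //.
have E : (t * r = t * (r - i) + t * i)%N by rewrite -mulnDr subnK.
case: leqP => [le_i|lt_i]; last first.
  rewrite (_ : 'C((r - i) * t + u + S - i, S) = 0)%N ?mulr0 // bin_small //.
  by rewrite mulnC; lia.
congr (_ * 'C(_, _)%:R); rewrite [X in _ = (X + _ + _ - _)%N]mulnC.
by move: E le_i; rewrite mulSn; lia.
Qed.

Lemma card_split_sums n s t h v : (s <= n)%N ->
  #|[set f : {ffun 'I_n -> 'I_t.+1} |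
     (\sum_(i < n | (i < s)%N) f i == h)%N &&
     (\sum_(i < n | ~~ (i < s)%N) f i == v)%N]%SET|%:R =
  (box_poly t ^+ s)`_h * (box_poly t ^+ (n - s))`_v :> rat.
Proof.
move=> le_sn.
(* The inner variable marks the sum over the first [s] coordinates, the outer one the sum over the
   rest. *)
pose w (i : 'I_n) (k : 'I_t.+1) : {poly {poly rat}} :=
  if (i < s)%N then ('X^k)%:P else 'X^k.
have cs : #|[pred i : 'I_n | (i < s)%N]| = s.
  rewrite -sum1_card (eq_bigl (fun i : 'I_n => (i < s)%N)) //.
  by rewrite -(big_ord_widen n (fun=> 1%N)) // sum1_card card_ord.
have cs' : #|[pred i : 'I_n | ~~ (i < s)%N]| = (n - s)%N.
  transitivity #|[predC [pred i : 'I_n | (i < s)%N]]|; first exact: eq_card.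
  by apply/eqP; rewrite -(eqn_add2l s) -[X in (X + _)%N == _]cs cardC card_ord
    subnKC.
have L : \prod_i \sum_k w i k =
    (box_poly t ^+ s)%:P * map_poly polyC (box_poly t ^+ (n - s)).
  rewrite (bigID (fun i : 'I_n => (i < s)%N)) /=; congr (_ * _).
    transitivity (\prod_(i in [pred i : 'I_n | (i < s)%N]) (box_poly t)%:P).
      by apply: eq_bigr => i; rewrite /w => ->; rewrite -rmorph_sum.
    by rewrite prodr_const cs rmorphXn.
  transitivity (\prod_(i in [pred i : 'I_n | ~~ (i < s)%N]) map_poly polyC
    (box_poly t)).
    apply: eq_bigr => i; rewrite /w => /negbTE ->; rewrite rmorph_sum.
    by apply: eq_bigr => k _; rewrite /= map_polyXn.
  by rewrite prodr_const cs' rmorphXn.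
have R (f : {ffun 'I_n -> 'I_t.+1}) : \prod_i w i (f i) =
  ('X^(\sum_(i < n | (i < s)%N) f i)%N)%:P *
  'X^(\sum_(i < n | ~~ (i < s)%N) f i)%N.
  rewrite (bigID (fun i : 'I_n => (i < s)%N)) /= -!prodrXr rmorph_prod /=.
  by congr (_ * _); apply: eq_bigr => i; rewrite /w; case: (i < s)%N.
have := congr1 (fun q : {poly {poly rat}} => q`_v`_h) L.
rewrite bigA_distr_bigA /= coefCM coef_map /= coefMC => <-.
rewrite !coef_sum -sum1_card natr_sum big_mkcond /=; apply: eq_bigr => f _.
rewrite R coefCM coefXn inE [_ == v]eq_sym; case: (v == _)%N.
  by rewrite mulr_natr mulr1n andbT coefXn eq_sym; case: (_ == _)%N.
by rewrite mulr_natr mulr0n andbF coef0.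
Qed.

(** Values in ['I_t.+1] build in the bounds of the box and make the set finite. *)
Definition panhandle_points n s r t : {set {ffun 'I_n -> 'I_t.+1}} :=
  [set f : {ffun 'I_n -> 'I_t.+1} | (\sum_i f i == t * r)%N &&
     (\sum_(i < n | ~~ (i < s)%N) f i <= t)%N]%SET.

Lemma card_panhandle_points n S r t : (r <= S)%N -> (S.+1 < n)%N ->
  #|panhandle_points n S.+1 r.+1 t|%:R =
  \sum_(a < r.+1) \sum_(u < t.+1)
    'C(t - u + (n - S.+2), n - S.+2)%:R *
    katzman_coef S (r - a) (a * t + u) :> rat.
Proof.
move=> le_rS lt_Sn; rewrite exchange_big /=.
pose hd (f : {ffun 'I_n -> 'I_t.+1}) := (\sum_(i < n | (i < S.+1)%N) f i)%N.
pose tl (f : {ffun 'I_n -> 'I_t.+1}) := (\sum_(i < n | ~~ (i < S.+1)%N) f i)%N.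
(* [u] is the slack [t - tl f] of the tail sum; the total [t (r + 1)] then forces the head sum
   [t r + u]. *)
transitivity (\sum_(u < t.+1) #|[set f : {ffun 'I_n -> 'I_t.+1} |
  (hd f == t * r + u)%N && (tl f == t - u)%N]%SET|%:R : rat); last first.
  apply: eq_bigr => u _; rewrite card_split_sums ?(ltnW lt_Sn) //.
  have le_ut : (u <= t)%N by rewrite -ltnS.
  rewrite coef_box_poly_katzman // -(subnSK lt_Sn) coef_box_poly_small
    ?leq_subr //.
  by rewrite mulrC mulr_sumr.
rewrite -natr_sum; congr _%:R; rewrite -sum1_card.
under [RHS]eq_bigr => u _ do rewrite -sum1_card big_mkcond.
rewrite exchange_big big_mkcond /=; apply: eq_bigr => f _.
rewrite -big_mkcond /= sum1_card inE.
have -> : (\sum_i f i = hd f + tl f)%N.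
  by rewrite (bigID (fun i : 'I_n => (i < S.+1)%N)).
rewrite -/(tl f); case: ifP => [/andP[/eqP E le_tl]|/negbT H].
  have lt_u : (t - tl f < t.+1)%N by rewrite ltnS leq_subr.
  rewrite -(card1 (Ordinal lt_u)); apply: eq_card => u;
    rewrite !inE -val_eqE /= unfold_in /= -[RHS]/(f \in finset _) inE.
  by have := ltn_ord u; rewrite mulnS in E; lia.
apply/esym/eq_card0 => u; rewrite unfold_in /= -[LHS]/(f \in finset _) inE;
  apply/negbTE; apply: contra H.
move=> /andP[/eqP -> /eqP ->]; rewrite mulnS leq_subr andbT.
by have := ltn_ord u; lia.
Qed.

(** * Lattice points of dilated panhandle polytopes *)

Lemma subset_between (T : finType) (A C : {set T}) k :
  A \subset C -> (#|A| <= k <= #|C|)%N ->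
  exists B : {set T}, [/\ A \subset B, B \subset C & #|B| = k].
Proof.
elim: k => [|k IHk] sAC /andP[leAk lekC].
  by exists A; split => //; apply/eqP; rewrite -leqn0.
have [/eqP eAk|ltAk] := boolP (#|A| == k.+1)%N; first by exists A.
have [|B [sAB sBC cB]] := IHk sAC; first by lia.
have [b bC bB] : exists2 b, b \in C & b \notin B.
  by apply/fintype.subsetPn/negP => /subset_leq_card; rewrite cB leqNgt lekC.
exists (b |: B)%SET; split; last by rewrite cardsU1 bB cB.
  exact: fintype.subset_trans sAB (finset.subsetUr _ _).
by rewrite finset.subUset finset.sub1set bC.
Qed.

(** [B] must contain the indices of value [t] and avoid those of value 0. There are at most [k] of
    the former, as the sum is below [t (k + 1)], and at least [k] indices of positive value, as it
    exceeds [t (k - 1)]. *)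
Lemma extract_layer (T : finType) (D : {set T}) (g : T -> nat) t k :
  (forall i, g i <= t)%N ->
  (\sum_(i in D) g i < t * k.+1)%N -> (t * k < \sum_(i in D) g i + t)%N ->
  exists B : {set T}, [/\ B \subset D, #|B| = k,
    (forall i, i \in B -> (0 < g i)%N)
    & forall i, i \in D -> g i = t -> i \in B].
Proof.
move=> le_gt lt_s gt_s.
have t0 : (0 < t)%N by case: t {le_gt} lt_s gt_s => //; rewrite mul0n.
pose F := [set i in D | g i == t]%SET; pose C := [set i in D | (0 < g i)%N]%SET.
have sF : (t * #|F| <= \sum_(i in D) g i)%N.
  rewrite -sum1_card big_distrr /= [leqRHS]big_mkcond [leqLHS]big_mkcond /=.
  apply: leq_sum => i _; rewrite inE; case: (i \in D) => //=.
  by case: eqP => [->|_]; rewrite ?muln1.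
have sC : (\sum_(i in D) g i <= t * #|C|)%N.
  rewrite -sum1_card big_distrr /= [leqRHS]big_mkcond [leqLHS]big_mkcond /=.
  apply: leq_sum => i _; rewrite inE; case: (i \in D) => //=.
  by case: (g i) (le_gt i) => [|m] //= le_m; rewrite muln1.
have [||B [sFB sBC cB]] := @subset_between _ F C k.
- by apply/fintype.subsetP => i; rewrite !inE => /andP[-> /eqP ->].
- apply/andP; split.
    by rewrite -ltnS -(ltn_pmul2l t0) (leq_ltn_trans sF).
  by rewrite -ltnS -(ltn_pmul2l t0) mulnS addnC; apply: leq_trans gt_s _;
    rewrite leq_add2r.
exists B; split => //.
- by apply: fintype.subset_trans sBC _; apply/fintype.subsetP => i;
    rewrite inE => /andP[].
- by move=> i /(fintype.subsetP sBC); rewrite inE => /andP[].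
by move=> i iD gi; apply: (fintype.subsetP sFB); rewrite inE iD gi /=.
Qed.

(** * Peeling a basis off a point *)

Section Points.
Variables (n s r : nat).
Local Notation M := (panhandle_bases r.+1 s n).
Local Notation hd := [set i : 'I_n | (i < s)%N]%SET.
Local Notation tl := [set i : 'I_n | ~~ (i < s)%N]%SET.

(** Natural-valued counterpart of [panhandle_points], in which [t] can vary along an induction. *)
Definition panhandle_point t (g : 'I_n -> nat) : Prop :=
  [/\ (forall i, g i <= t)%N, (\sum_i g i = t * r.+1)%N &
      (\sum_(i in tl) g i <= t)%N].

Lemma sum_split (g : 'I_n -> nat) :
  (\sum_i g i = \sum_(i in hd) g i + \sum_(i in tl) g i)%N.
Proof.
rewrite (bigID (fun i : 'I_n => (i < s)%N)) /=.
by congr (_ + _)%N; apply: eq_bigl => i; rewrite inE.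
Qed.

(** The basis must contain every index of value [t.+1] and none of value 0; [extract_layer] supplies
    its head and its tail separately. *)
Lemma peel_basis t g : panhandle_point t.+1 g ->
  exists2 B, B \in M &
    (forall i, i \in B -> (0 < g i)%N) /\
    panhandle_point t (fun i => g i - (i \in B))%N.
Proof.
move=> [le_gt sg tg]; have := sum_split g; rewrite sg => sgE.
(* [k] is the number of tail elements of the basis: one exactly when the tail sum is [t.+1] and has
   to drop to [t]. *)
have [k kE] : exists k, (\sum_(i in tl) g i < t.+1 /\ k = 0 \/
    \sum_(i in tl) g i = t.+1 /\ k = 1)%N.
  by have [/eqP e|ne] := boolP (\sum_(i in tl) g i == t.+1)%N;
    [exists 1%N; right|exists 0%N; left; split => //; rewrite ltn_neqAle ne].
have k1 : (k <= 1)%N by case: kE => -[_ ->].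
have [||Bt [sBt cBt Btpos Btfull]] := @extract_layer _ tl g t.+1 k le_gt.
- by case: kE => -[h ->]; lia.
- by case: kE => -[h ->]; lia.
have [||Bh [sBh cBh Bhpos Bhfull]] := @extract_layer _ hd g t.+1 (r.+1 - k)
  le_gt.
- move: sgE kE; move: (\sum_(i in hd) _)%N (\sum_(i in tl) _)%N => H T.
  by rewrite !mulnS => sgE [] [h ->]; rewrite ?subn0 ?subn1 /= ?mulnS; lia.
- move: sgE kE; move: (\sum_(i in hd) _)%N (\sum_(i in tl) _)%N => H T.
  by rewrite !mulnS => sgE [] [h ->]; rewrite ?subn0 ?subn1 /= ?mulnS; lia.
have inBt i : i \in Bt -> ~~ (i < s)%N.
  by move/(fintype.subsetP sBt); rewrite inE.
have inBh i : i \in Bh -> (i < s)%N by move/(fintype.subsetP sBh); rewrite inE.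
have dis : [disjoint Bh & Bt].
  by apply/fintype.pred0P => i /=; apply/negP => /andP[/inBh ih /inBt];
    rewrite ih.
have cB : #|(Bh :|: Bt)%SET| = r.+1.
  by rewrite cardsU (disjoint_setI0 dis) cards0 subn0 cBh cBt subnK //; lia.
have Bpos i : i \in (Bh :|: Bt)%SET -> (0 < g i)%N.
  by rewrite inE => /orP[/Bhpos|/Btpos].
exists (Bh :|: Bt)%SET.
  rewrite inE cB eqxx /= subn1 /=;
    apply: leq_trans (subset_leq_card (_ : Bh \subset _)).
    by rewrite cBh; lia.
  apply/fintype.subsetP => i iB; rewrite !inE iB /=; exact: inBh.
split=> //.
have sumB (D : {set 'I_n}) : (\sum_(i in D) (g i - (i \in (Bh :|: Bt)%SET)) +
   #|D :&: (Bh :|: Bt)| = \sum_(i in D) g i)%N.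
  have -> : #|(D :&: (Bh :|: Bt))%SET| =
      (\sum_(i in D) (i \in (Bh :|: Bt)%SET))%N.
    rewrite -sum1_card big_mkcond [RHS]big_mkcond; apply: eq_bigr => i _.
    by rewrite finset.in_setI; case: (i \in D); case: (i \in _).
  rewrite -big_split; apply: eq_bigr => i _ /=; rewrite subnK //.
  by case: (boolP (i \in _)) => // /Bpos.
split.
- move=> i; case: (boolP (i \in _)) => [iB|]; first by have := le_gt i; lia.
  rewrite inE negb_or subn0 => /andP[iBh iBt].
  have := le_gt i; rewrite leq_eqVlt => /predU1P[e|//].
  have [lt_is|ge_is] := boolP (i < s)%N.
    by move: iBh; rewrite Bhfull // inE.
  by move: iBt; rewrite Btfull // inE.
- have := sumB [set: 'I_n]%SET; rewrite finset.setTI cB.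
  rewrite (eq_bigl xpredT) => [|i]; last by rewrite inE.
  rewrite [X in _ = X -> _](eq_bigl xpredT) => [|i]; last by rewrite inE.
  by rewrite sg mulSn addnC => /addnI.
have := sumB tl; have -> : (tl :&: (Bh :|: Bt) = Bt)%SET.
  apply/finset.setP => i; rewrite !inE.
  case: (boolP (i \in Bt)) => [/inBt ->|_]; rewrite ?orbT // orbF.
  by apply/negP => /andP[/negP ns /inBh].
rewrite cBt; move: kE; move: (\sum_(i in tl) g i)%N => T;
  move: (\sum_(i in tl) _)%N => T'.
by lia.
Qed.

End Points.

(** * Integer points of the dilated polytope *)

Section Geometry.
Variables (R : realType) (n s r : nat).
Variables (r_gt0 : (0 < r.+1)%N) (le_rs : (r.+1 <= s)%N) (lt_sn : (s < n)%N).
Local Notation P := (base_polytope R (panhandle r_gt0 le_rs lt_sn)).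
Local Notation tl := [set i : 'I_n | ~~ (i < s)%N]%SET.

Definition point_of (g : 'I_n -> nat) : 'rV[R]_n := \row_i (g i)%:R.

Lemma indicator_in_polytope B : B \in panhandle_bases r.+1 s n ->
  P (indicator_vector R B).
Proof. by move=> BM; apply: sub_gen_smallest; exists B. Qed.

Lemma polytope_convex (x y : 'rV[R]_n) (a : R) : 0 <= a <= 1 -> P x -> P y ->
  P (a *: x + (1 - a) *: y).
Proof.
move=> /andP[a0 a1] Px Py D [cD sD].
have /mem_set Dx := Px D (conj cD sD); have /mem_set Dy := Py D (conj cD sD).
pose l : {i01 R} := Itv01 a0 a1.
exact: set_mem (cD x y l Dx Dy).
Qed.

(** A half-space is convex, so it contains the hull as soon as it contains the vertices. *)
Lemma polytope_halfspace (w : 'I_n -> R) (c : R) :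
  (forall B, B \in panhandle_bases r.+1 s n -> \sum_(i in B) w i <= c) ->
  forall x, P x -> \sum_i w i * x 0 i <= c.
Proof.
move=> Hw; apply: (@smallest_sub _ _ _
  [set x : 'rV[R]_n | \sum_i w i * x 0 i <= c]%classic).
  move=> x y l /set_mem /= xc /set_mem /= yc; apply/mem_set => /=.
  have -> : \sum_i w i * (conv l x y : 'rV[R]_n) 0 i =
     l%:num * (\sum_i w i * x 0 i) + (1 - l%:num) * (\sum_i w i * y 0 i).
    rewrite !mulr_sumr -big_split /=; apply: eq_bigr => i _.
    by rewrite !mxE /onem; ring.
  have l0 : 0 <= l%:num by [].
  have l1 : l%:num <= 1 by [].
  have -> : c = l%:num * c + (1 - l%:num) * c by ring.
  by apply: lerD; apply: ler_wpM2l => //; rewrite subr_ge0.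
move=> _ [B BM <-] /=; apply: le_trans (Hw B BM).
rewrite [leRHS]big_mkcond /=; apply: ler_sum => i _.
by rewrite mxE; case: (i \in B); rewrite ?mulr1 ?mulr0.
Qed.

Lemma point_in_dilate t g : panhandle_point s r t g -> dilate t P (point_of g).
Proof.
elim: t g => [|t IHt] g.
  (* The dilate by 0 contains the origin because the polytope is nonempty; any basis serves. *)
  move=> [g0 _ _]; have [B BM] : exists B, B \in panhandle_bases r.+1 s n.
    exact/set0Pn/panhandle_bases_neq0.
  exists (indicator_vector R B); first exact: indicator_in_polytope.
  rewrite scale0r; apply/rowP => i; rewrite !mxE.
  by have := g0 i; rewrite leqn0 => /eqP ->.
move=> /peel_basis[B BM [Bpos /IHt[x Px xE]]].
(* Chosen so that its multiple by [t.+1] is [t *: x] plus the indicator vector of [B]. *)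
exists (t.+1%:R^-1 *: indicator_vector R B + (1 - t.+1%:R^-1) *: x).
  apply: polytope_convex => //; last exact: indicator_in_polytope.
  by rewrite invr_ge0 ler0n /= invf_le1 ?ler1n ?ltr0n.
rewrite scalerDr !scalerA mulfV ?pnatr_eq0 // mulrBr mulr1 mulfV ?pnatr_eq0 //.
rewrite -natr1 addrK scale1r xE; apply/rowP => i; rewrite !mxE -natrD;
  congr _%:R.
by rewrite subnKC //; case: (boolP (i \in B)) => // /Bpos.
Qed.

Lemma dilate_bound t (w : 'I_n -> R) (c : R) x :
  (forall B, B \in panhandle_bases r.+1 s n -> \sum_(i in B) w i <= c) ->
  dilate t P x -> \sum_i w i * x 0 i <= t%:R * c.
Proof.
move=> Hw [y Py <-].
have -> : \sum_i w i * (t%:R *: y) 0 i = t%:R * \sum_i w i * y 0 i.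
  by rewrite mulr_sumr; apply: eq_bigr => i _; rewrite mxE; ring.
by apply: ler_wpM2l; rewrite ?ler0n // polytope_halfspace.
Qed.

(** Each condition comes from a linear form bounded on the bases: minus a coordinate by 0, a
    coordinate by 1, plus or minus the total by plus or minus [r + 1], and the tail sum by 1. *)
Lemma dilate_in_point t x : dilate t P x -> integer_points R n x ->
  exists2 g, panhandle_point s r t g & x = point_of g.
Proof.
move=> tx [z _ zx]; have D w c := @dilate_bound t w c x ^~ tx.
have sum1 (B : {set 'I_n}) i (a : R) :
    \sum_(j in B) (if j == i then a else 0) = if i \in B then a else 0.
  rewrite -big_mkcondr /=; case: ifP => iB.
    rewrite (big_pred1 i) // => j /=; case: eqP => [->|]; rewrite ?iB ?andbF //.
  by rewrite big1 // => j /andP[jB /eqP ji]; rewrite -ji jB in iB.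
have sumi i (a : R) : \sum_j (if j == i then a else 0) * x 0 j = a * x 0 i.
  rewrite (bigD1 i) //= eqxx big1 ?addr0 // => j /negbTE ->.
  by rewrite mul0r.
have ge0 i : 0 <= x 0 i.
  have := D (fun j => if j == i then -1 else 0) 0;
    rewrite sumi mulr0 mulN1r oppr_le0.
  by apply=> B _; rewrite sum1; case: ifP => // _; rewrite oppr_le0.
have le_t i : x 0 i <= t%:R.
  have := D (fun j => if j == i then 1 else 0) 1; rewrite sumi mulr1 mul1r.
  by apply=> B _; rewrite sum1; case: ifP.
have zE i : (z 0 i)%:~R = x 0 i by rewrite -zx mxE.
pose g i := absz (z 0 i).
have gE i : (g i)%:R = x 0 i.
  by rewrite -zE /g natr_absz ger0_norm // -(ler0z R) zE.
have cardB B : B \in panhandle_bases r.+1 s n ->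
    #|B| = r.+1 /\ (#|B :&: tl| <= 1)%N.
  rewrite inE subn1 /= => /andP[/eqP cB sB]; split=> //.
  have := cardsID (initial_segment s n) B; rewrite cB => E.
  have -> : #|(B :&: tl)%SET| = #|(B :\: initial_segment s n)%SET|.
    by apply: eq_card => i; rewrite !inE andbC.
  by rewrite -(leq_add2l r) addn1 -E leq_add2r.
exists g; last by apply/rowP => i; rewrite mxE gE.
split.
- by move=> i; rewrite -(ler_nat R) gE.
- apply/eqP; rewrite -(@eqr_nat R) natr_sum natrM.
  rewrite (eq_bigr (fun i => x 0 i)) => [|i _]; last exact: gE.
  rewrite eq_le; apply/andP; split.
    have : \sum_i 1 * x 0 i <= t%:R * r.+1%:R.
      by apply: (D (fun=> 1)) => B /cardB[cB _]; rewrite sumr_const cB.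
    by under [X in X <= _ -> _]eq_bigr => i _ do rewrite mul1r.
  have : \sum_i -1 * x 0 i <= t%:R * - r.+1%:R.
    by apply: (D (fun=> -1)) => B /cardB[cB _]; rewrite sumr_const cB mulNrn.
  under [X in X <= _ -> _]eq_bigr => i _ do rewrite mulN1r.
  by rewrite sumrN mulrN lerN2.
rewrite -(ler_nat R) natr_sum.
have := D (fun i => (i \in tl)%:R) 1; rewrite mulr1.
have -> : \sum_i (i \in tl)%:R * x 0 i = \sum_(i in tl) (g i)%:R.
  rewrite [RHS]big_mkcond; apply: eq_bigr => i _; rewrite gE.
  by case: (i \in tl); rewrite ?mul1r ?mul0r.
apply=> B /cardB[_ cB].
have -> : \sum_(i in B) (i \in tl)%:R = #|(B :&: tl)%SET|%:R :> R.
  rewrite -sum1_card natr_sum big_mkcond [RHS]big_mkcond /=;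
    apply: eq_bigr => i _.
  by rewrite finset.in_setI; case: (i \in B); case: (i \in tl).
by rewrite lern1.
Qed.

Lemma lattice_points_image t :
  (dilate t P `&` integer_points R n =
   [set point_of (fun i => val (f i)) |
     f in [set` panhandle_points n s r.+1 t]])%classic.
Proof.
apply/seteqP; split => [x [tx ix]|_ [f fL <-]].
  have [g [g_t sg tg] ->] := dilate_in_point tx ix.
  have fE : (fun i => val ([ffun i => inord (g i)] i : 'I_t.+1)) = g.
    by apply: funext => i; rewrite ffunE /= inordK ?ltnS.
  exists [ffun i => inord (g i)]; last by rewrite fE.
  rewrite /= inE.
  have e i : ([ffun i => inord (g i)] i : 'I_t.+1) = g i :> nat.
    exact: (congr1 (fun h => h i) fE).
  rewrite (eq_bigr g) => [|i _]; last exact: e.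
  rewrite [X in _ && (X <= _)%N](eq_bigr g) => [|i _]; last exact: e.
  rewrite sg eqxx /=; move: tg; congr (_ <= _)%N; apply: eq_bigl => i.
  by rewrite inE.
move: fL; rewrite /= inE => /andP[/eqP sf tf]; split.
  apply: point_in_dilate; split=> [i|//|]; first by rewrite -ltnS ltn_ord.
  by move: tf; congr (_ <= _)%N; apply: eq_bigl => i; rewrite inE.
exists (\row_i (val (f i))%:Z) => //; apply/rowP => i; rewrite !mxE.
by rewrite -pmulrn.
Qed.

Lemma card_lattice_points t :
  finite_set (dilate t P `&` integer_points R n)%classic /\
  #|` fset_set (dilate t P `&` integer_points R n)%classic| =
    #|panhandle_points n s r.+1 t|.
Proof.
rewrite lattice_points_image;
  have fin := @finite_finpred _ _ (panhandle_points n s r.+1 t).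
split; first exact: finite_image.
rewrite fset_set_image // card_imfset /=; last first.
  move=> f g /rowP E; apply/ffunP => i; apply/val_inj/eqP.
  by have := E i; rewrite !mxE => /eqP; rewrite eqr_nat.
rewrite cardE; apply/perm_size/uniq_perm; rewrite ?fset_uniq ?enum_uniq // => f.
by rewrite mem_enum in_fset_set //; apply/idP/idP => [/set_mem|/mem_set].
Qed.

End Geometry.

Theorem theorem1p3 (R : realType) (r s n : nat) (r_gt0 : (0 < r)%N)
    (le_rs : (r <= s)%N) (lt_sn : (s < n)%N) :
  ehrhart_positive R (panhandle r_gt0 le_rs lt_sn).
Proof.
case: r s r_gt0 le_rs lt_sn => [//|r] [//|S] r_gt0 le_rs lt_sn.
(* [n - S.+2] is [d - 1] for [d = n - s], since [s] is now [S.+1]. *)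
have [q q0 qE] := katzman_sum_poly (n - S.+2) le_rs.
exists q => // t; have [fin ->] := card_lattice_points R r_gt0 le_rs lt_sn t.
by split=> //; rewrite qE card_panhandle_points.
Qed.
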